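(* Let $n\ge 1$, $\pi=\pi_1\cdots\pi_n\in S_n$ and $1\le i\le n$. Then $\mathrm{bump}_i(\pi)$ is one less than the smallest value of $j\ge 1$ such that the maximal size of the union of $j$ increasing subsequences in $\pi_1\ldots\pi_{i-1}\pi_i$ is greater than the maximal size of the union of $j$ increasing subsequences in $\pi_1\ldots\pi_{i-1}$.
   Context: $S_n$ is the set of permutations $\pi=\pi_1\cdots\pi_n$ (one-line notation) of $\{1,\ldots,n\}$. Increasing subsequences may be empty; for $i=1$ the sequence $\pi_1\ldots\pi_{i-1}$ is empty and the corresponding maximal size is $0$. Robinson–Schensted (RS) correspondence: tableaux are fillings of Young diagrams with distinct positive integers increasing along rows and down columns. To insert $k$ into a tableau $P$ (written $P\leftarrow k$), start with the top row: (I1) if $k$ is greater than or equal to the rightmost entry of the current row, or the current row is empty, append $k$ at the end of that row and stop; (I2) otherwise let $y$ be the leftmost entry of the current row with $k<y$, replace $y$ by $k$ (this is one bump), set $k:=y$, move down one row and go to (I1). For $\pi\in S_n$, let $P_0$ be the empty tableau and $P_i=P_{i-1}\leftarrow\pi_i$ for $1\le i\le n$. Then $\mathrm{bump}_i(\pi)$ is the number of bumps that occur during the insertion $P_{i-1}\leftarrow\pi_i$. *)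

(* Defs.v *)
From mathcomp Require Import all_boot all_fingroup.

Set Implicit Arguments.
Unset Strict Implicit.
Unset Printing Implicit Defensive.

(* Words and the rows of a tableau are sequences of positive integers; a
   tableau is the sequence of its rows, from top to bottom. *)
Definition tableau := seq (seq nat).

(* 'I_n is {0, ..., n-1}, hence the successor on values. *)
Definition one_line (n : nat) (pi : 'S_n) : seq nat :=
  [seq (pi x).+1 | x <- enum 'I_n].

(* The tableau P <- k, together with the number of bumps that occur in this
   insertion. Row number (size P).+1 of P is empty, so k settles there. *)
Fixpoint rs_insert (P : tableau) (k : nat) : tableau * nat :=
  if P is row :: P' then
    if (row == [::]) || (last 0 row <= k) then (rcons row k :: P', 0)
    else
      let p := find (fun y => k < y) row in
      let: (Q, b) := rs_insert P' (nth 0 row p) in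
      (set_nth 0 row p k :: Q, b.+1)
  else ([:: [:: k]], 0).

Definition P_tableau (w : seq nat) : tableau :=
  foldl (fun P k => (rs_insert P k).1) [::] w.

(* i is 1-based, as in pi_1 ... pi_n, while nth is 0-based. *)
Definition rs_bump (n : nat) (i : nat) (pi : 'S_n) : nat :=
  (rs_insert (P_tableau (take i.-1 (one_line pi))) (nth 0 (one_line pi) i.-1)).2.

(* A subsequence of w is given by its set A of positions, which enum lists in
   increasing order. *)
Definition subword (w : seq nat) (A : {set 'I_(size w)}) : seq nat :=
  [seq nth 0 w p | p : 'I_(size w) <- enum A].

Definition increasing (w : seq nat) (A : {set 'I_(size w)}) : bool :=
  sorted ltn (subword A).

(* The j increasing subsequences may overlap, coincide or be empty. *)
Definition max_union_incr (j : nat) (w : seq nat) : nat :=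
  \max_(F : {ffun 'I_j -> {set 'I_(size w)}} | [forall t, increasing (F t)])
     #|\bigcup_(t < j) F t|.

Definition is_smallest (Q : nat -> Prop) (j : nat) : Prop :=
  Q j /\ forall j', Q j' -> j <= j'.

(* Main.v *)
Require Import Defs.
From mathcomp Require Import all_boot all_fingroup zify.

Set Implicit Arguments.
Unset Strict Implicit.
Unset Printing Implicit Defensive.

(** The statement follows from Greene's theorem for increasing subsequences
    ([greene]): the largest union of [j] increasing subsequences of [w] has as
    many elements as the first [j] rows of the tableau of [w] together. Indeed
    an insertion with [b] bumps lengthens the row of index [b] (counted from 0)
    and no other row ([rs_insert_row_sizes]), so the sum of the first [j] row
    sizes increases exactly when [b < j], and the least such [j] is [b + 1].

    For Greene's theorem, a family of [j] increasing subsequences is replaced by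
    a colouring of the letters: those of colour [t < j] must increase, and those
    of colour at least [j] are left uncovered. Three facts are combined.

    - Elementary Knuth moves do not change the numbers of letters that such
      colourings can cover. In one direction the same colouring works
      ([coverable_transpose]); in the other ([coverable_knuth_xzy_zxy] and
      [coverable_knuth_yxz_yzx]) two letters that a single colour joins become
      inverted, and the cure is to exchange that colour with the colour of the
      letter of intermediate value, from some point of the word on.

    - Row insertion is a succession of Knuth moves, so a word can be changed by
      such moves into the reading word of its tableau, the rows being read from
      bottom to top ([P_tableau_correct]).

    - In the reading word of a tableau the [j] top rows are increasing
      ([coverable_reading]). Nothing covers more ([coverable_reading_le]),
      since each column is read in decreasing order, so that it contributes at
      most one letter per colour, hence at most [j] letters. *)

(** * Colourings that stand for families of increasing subsequences *)

(** Only pairs of letters matter, so that a colouring of a word is a [pairwise]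
    condition, which decomposes along concatenations. Colours are attached to
    the values of the letters: this is faithful on words without repetition, and
    it lets a colouring be carried over unchanged when letters are permuted. *)
Definition compatible (j : nat) (c : nat -> nat) : rel nat :=
  fun u v => (c u < j) && (c u == c v) ==> (u < v).
Definition coloring j c (w : seq nat) := pairwise (compatible j c) w.
Definition coverable j w m :=
  exists2 c, coloring j c w & count (fun v => c v < j) w = m.

Definition switch (s t k : nat) :=
  if k == s then t else if k == t then s else k.

Lemma pairwise_catP (r : rel nat) u v :
  reflect [/\ pairwise r u, pairwise r v & forall x y, x \in u -> y \in v -> r x y]
          (pairwise r (u ++ v)).
Proof.
rewrite pairwise_cat; apply: (iffP and3P) => [[/allrelP ? ? ?]|[? ? ?]]; split=> //.
exact/allrelP.
Qed.

Lemma coloring_transpose j c a b x z : compatible j c x z ->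
  coloring j c (a ++ [:: z; x] ++ b) -> coloring j c (a ++ [:: x; z] ++ b).
Proof.
move=> xz /pairwise_catP[ca /pairwise_catP[_ cb czxb] cazx].
have E : [:: z; x] =i [:: x; z] by move=> u; rewrite !inE orbC.
apply/pairwise_catP; split=> //; last first.
  by move=> u v ua; rewrite mem_cat -E -mem_cat; apply: cazx.
apply/pairwise_catP; split=> //; first by rewrite /= xz.
by move=> u v; rewrite -E; apply: czxb.
Qed.

Lemma coverable_transpose j c a b x z : compatible j c x z ->
  coloring j c (a ++ [:: z; x] ++ b) ->
  coverable j (a ++ [:: x; z] ++ b) (count (fun v => c v < j) (a ++ [:: z; x] ++ b)).
Proof.
move=> xz /(coloring_transpose xz) cw; exists c => //.
by rewrite !count_cat /= !addn0 [X in _ + (X + _)]addnC.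
Qed.

Lemma eq_coloring j c c' w : {in w, c =1 c'} -> coloring j c w -> coloring j c' w.
Proof.
move=> E; rewrite /coloring => cw; apply: (sub_in_pairwise (P := mem w)) cw.
  by move=> u v /E eu /E ev; rewrite /compatible eu ev.
exact/allP.
Qed.

(** The common frame of the two recolourings below, which alter a word [a l b]
    only within [l]: it reduces the validity of the new colouring to conditions
    on single letters of [a] and [b] against the three letters of [l]. *)
Lemma coverable_recolor j c c' a l l' b : coloring j c (a ++ l ++ b) ->
  {in a, c =1 c'} ->
  coloring j c' b -> (forall v, v \in b -> (c v < j) = (c' v < j)) ->
  coloring j c' l' -> count (fun v => c' v < j) l' = count (fun v => c v < j) l ->
  (forall u v, u \in a -> v \in b -> (forall v', v' \in l -> compatible j c u v') ->
     (forall u', u' \in l -> compatible j c u' v) ->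
     compatible j c u v -> compatible j c' u v) ->
  (forall u, u \in a -> (forall v, v \in l -> compatible j c u v) ->
     forall v, v \in l' -> compatible j c' u v) ->
  (forall v, v \in b -> (forall u, u \in l -> compatible j c u v) ->
     forall u, u \in l' -> compatible j c' u v) ->
  coverable j (a ++ l' ++ b) (count (fun v => c v < j) (a ++ l ++ b)).
Proof.
move=> /pairwise_catP[ca /pairwise_catP[cl cb clb] calb] ea cb' eb cl' el cab' cal' clb'.
exists c'; last first.
  rewrite !count_cat el; congr (_ + (_ + _)); apply: eq_in_count => v; last by move/eb.
  by move/ea=> ->.
apply/pairwise_catP; split; first exact: eq_coloring ca.
  apply/pairwise_catP; split=> // u v ul' vb.
  by apply: clb' => // u' ul; apply: clb.
move=> u v ua; rewrite mem_cat => /orP[vl|vb].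
  by apply: cal' => // v' vl'; apply: calb => //; rewrite mem_cat vl'.
apply: cab' => //; [move=> v' v'l|move=> u' u'l; exact: clb|].
  by apply: calb => //; rewrite mem_cat v'l.
by apply: calb => //; rewrite mem_cat vb orbT.
Qed.

Lemma forall_mem3 (P : nat -> Prop) x y z :
  (forall u, u \in [:: x; y; z] -> P u) <-> [/\ P x, P y & P z].
Proof.
split=> [H|[Px Py Pz] u]; first by split; apply: H; rewrite !inE eqxx ?orbT.
by rewrite !inE => /or3P[] /eqP->.
Qed.

Lemma uniq_cat3 (a l b : seq nat) : uniq (a ++ l ++ b) ->
  [/\ forall u, u \in a -> u \notin l, forall u, u \in a -> u \notin b
    & forall u, u \in l -> u \notin b].
Proof.
rewrite uniq_pairwise => /pairwise_catP[_ /pairwise_catP[_ _ lb] alb].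
split=> u uu; apply/negP => uu'.
- by have := alb u u uu; rewrite mem_cat uu' /= eqxx => /(_ isT).
- by have := alb u u uu; rewrite mem_cat uu' orbT /= eqxx => /(_ isT).
- by have := lb u u uu uu'; rewrite /= eqxx.
Qed.

(** Exchanging the colours [s] and [t] on the whole of [b] keeps [b] correctly
    coloured. When one of the two means uncovered, the exchange is restricted to
    [D], since on [b] it would change the number of covered letters. *)
Lemma tail_switch j c (a l b D : seq nat) s t : uniq (a ++ l ++ b) -> {subset D <= l} ->
  coloring j c b ->
  exists c',
    [/\ {in a, c' =1 c},
        {in l, forall v, c' v = if v \in D then switch s t (c v) else c v},
        {in b, forall v, c' v = if (s < j) && (t < j) then switch s t (c v) else c v}
      & coloring j c' b].
Proof.
move=> /uniq_cat3[al ab lb] Dl cb.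
pose E := if (s < j) && (t < j) then D ++ b else D.
have Eb v : v \in b -> (v \in E) = (s < j) && (t < j).
  move=> vb; rewrite /E; case: ifP => _; first by rewrite mem_cat vb orbT.
  by apply/negP => /Dl /lb; rewrite vb.
have El v : v \in l -> (v \in E) = (v \in D).
  by move=> vl; rewrite /E; case: ifP => // _; rewrite mem_cat (negbTE (lb _ vl)) orbF.
have Ea v : v \in a -> (v \in E) = false.
  move=> va; have vD: v \notin D by apply: contra (al _ va) => /Dl.
  by rewrite /E; case: ifP => _; rewrite ?mem_cat (negbTE vD) // (negbTE (ab _ va)).
pose c' v := if v \in E then switch s t (c v) else c v.
exists c'; split=> [v va|v vl|v vb|].
- by rewrite /c' Ea.
- by rewrite /c' El.
- by rewrite /c' Eb.
rewrite /coloring in cb *; move: cb.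
apply: (sub_in_pairwise (P := mem b)); last exact/allP.
move=> u v ub vb; rewrite /compatible /c' !Eb // /switch.
by case: ifP => ? //; do 4?[case: ifP]; lia.
Qed.

(** If [x] and [z] share the colour [t], with [y] of colour [s], the two classes
    run through [x z] and through [y]. After the move they are spliced as
    [x y], continued by the old tail of [s], and [z], continued by the old tail
    of [t]; this is the exchange of [s] and [t] from [z] on. If [y] was
    uncovered, then [y] takes the place of [z] instead. *)
Lemma coverable_knuth_xzy_zxy j c a b x y z : x < y < z ->
  uniq (a ++ [:: x; z; y] ++ b) ->
  coloring j c (a ++ [:: x; z; y] ++ b) ->
  coverable j (a ++ [:: z; x; y] ++ b)
    (count (fun v => c v < j) (a ++ [:: x; z; y] ++ b)).
Proof.
move=> xyz uw cw.
(* The colouring itself serves unless it joins [x] and [z]. *)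
case Ezx: (compatible j c z x); first exact: (coverable_transpose (b := y :: b)).
have [_ /pairwise_catP[cl cb _] _] := pairwise_catP _ _ _ cw.
rewrite /coloring /= /compatible in Ezx cl.
have Dl : {subset [:: z; y] <= [:: x; z; y]}.
  by move=> v; rewrite !inE => ->; rewrite orbT.
have [c' [Ea /forall_mem3[Ex Ez Ey] Eb cb']] := tail_switch (c y) (c z) uw Dl cb.
have {}Ex : c' x = c x by rewrite Ex !inE ifN //; lia.
have {}Ey : c' y = c z by rewrite Ey !inE eqxx orbT /switch eqxx.
have {}Ez : c' z = c y by rewrite Ez !inE eqxx /switch eqxx /=; case: eqP.
apply: (coverable_recolor cw (c' := c')) => //.
- by move=> v /Ea.
- by move=> v /Eb->; rewrite /switch; do 3?[case: ifP]; lia.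
- by rewrite /coloring /= /compatible Ex Ey Ez; lia.
- by rewrite /= Ex Ey Ez; lia.
- move=> u v ua vb /forall_mem3[ux _ uy] /forall_mem3[_ zv yv] uv.
  rewrite /compatible Ea // Eb //.
  move: ux uy zv yv uv; rewrite /compatible /switch => *.
  by do 3?[case: ifP]; lia.
- move=> u ua /forall_mem3[+ + +]; rewrite /compatible Ea // => ? ? ?.
  apply/forall_mem3; rewrite /= Ex Ey Ez.
  split; lia.
- move=> u ub /forall_mem3[+ + +]; rewrite /compatible Eb // /switch => ? ? ?.
  apply/forall_mem3; rewrite /= Ex Ey Ez.
  by split; do 3?[case: ifP]; lia.
Qed.

(** If [x] and [z] share the colour [t], with [y] of colour [s], the two classes
    are spliced as [x], continued by the old tail of [s], and [y z], continued
    by the old tail of [t]: the exchange of [s] and [t] starts at [z]. If [y]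
    was uncovered, then [y] takes the place of [x] instead. *)
Lemma coverable_knuth_yxz_yzx j c a b x y z : x < y < z ->
  uniq (a ++ [:: y; x; z] ++ b) ->
  coloring j c (a ++ [:: y; x; z] ++ b) ->
  coverable j (a ++ [:: y; z; x] ++ b)
    (count (fun v => c v < j) (a ++ [:: y; x; z] ++ b)).
Proof.
move=> xyz uw cw.
(* The colouring itself serves unless it joins [x] and [z]. *)
case Ezx: (compatible j c z x).
  rewrite -cat1s -[[:: y; x; z]]cat1s -!catA !(catA a).
  by apply: coverable_transpose; rewrite // -!catA.
have [_ /pairwise_catP[cl cb _] _] := pairwise_catP _ _ _ cw.
rewrite /coloring /= /compatible in Ezx cl.
(* On the three letters the exchange is confined to [z], or to [x] and [y],
   according to whether [y] is covered. *)
pose D := if c y < j then [:: z] else [:: x; y].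
have Dl : {subset D <= [:: y; x; z]}.
  by move=> v; rewrite /D; case: ifP => _; rewrite !inE; lia.
have [c' [Ea /forall_mem3[Ey Ex Ez] Eb cb']] := tail_switch (c y) (c z) uw Dl cb.
have {}Ex : c' x = if c y < j then c x else c y.
  by rewrite Ex /D /switch; case: ltnP; rewrite !inE; do 3?[case: ifP]; lia.
have {}Ey : c' y = if c y < j then c y else c z.
  by rewrite Ey /D /switch; case: ltnP; rewrite !inE; do 3?[case: ifP]; lia.
have {}Ez : c' z = if c y < j then c y else c z.
  by rewrite Ez /D /switch; case: ltnP; rewrite !inE; do 3?[case: ifP]; lia.
apply: (coverable_recolor cw (c' := c')) => //.
- by move=> v /Ea.
- by move=> v /Eb->; rewrite /switch; do 3?[case: ifP]; lia.
- by rewrite /coloring /= /compatible Ex Ey Ez; do ?case: ifP; lia.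
- by rewrite /= Ex Ey Ez; do ?case: ifP; lia.
- move=> u v ua vb /forall_mem3[uy ux _] /forall_mem3[yv _ zv] uv.
  rewrite /compatible Ea // Eb //.
  move: ux uy zv yv uv; rewrite /compatible /switch => *.
  by do 3?[case: ifP]; lia.
- move=> u ua /forall_mem3[+ + +]; rewrite /compatible Ea // => ? ? ?.
  apply/forall_mem3; rewrite /= Ex Ey Ez.
  by split; do ?case: ifP; lia.
- move=> u ub /forall_mem3[+ + +]; rewrite /compatible Eb // /switch => ? ? ?.
  apply/forall_mem3; rewrite /= Ex Ey Ez.
  by split; do ?[case: ifP => ? /=]; lia.
Qed.

(** * Knuth moves and row insertion *)

(** Equivalence of [u] and [v] as factors of an arbitrary word; the quantified
    context makes it a congruence for concatenation. It stands for Knuth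
    equivalence, of which only the effect on colourings is retained. *)
Definition exchangeable (u v : seq nat) :=
  perm_eq u v /\
  forall a b, uniq (a ++ u ++ b) ->
  forall j m, coverable j (a ++ u ++ b) m <-> coverable j (a ++ v ++ b) m.

Lemma exchangeable_refl u : exchangeable u u.
Proof. by split. Qed.

Lemma exchangeable_sym u v : exchangeable u v -> exchangeable v u.
Proof.
move=> [puv H]; split=> [|a b uv j m]; first by rewrite perm_sym.
by rewrite H // (perm_uniq (s2 := a ++ v ++ b)) // perm_cat2l perm_cat2r.
Qed.

Lemma exchangeable_trans v u w :
  exchangeable u v -> exchangeable v w -> exchangeable u w.
Proof.
move=> [puv Huv] [pvw Hvw]; split=> [|a b uu j m]; first exact: perm_trans pvw.
rewrite Huv // Hvw // -(perm_uniq (s1 := a ++ u ++ b)) //.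
by rewrite perm_cat2l perm_cat2r.
Qed.

Lemma exchangeable_cat a b u v :
  exchangeable u v -> exchangeable (a ++ u ++ b) (a ++ v ++ b).
Proof.
move=> [puv H]; split=> [|a' b']; first by rewrite perm_cat2l perm_cat2r.
by move: (H (a' ++ a) (b ++ b')); rewrite -!catA.
Qed.

Lemma exchangeable_knuth_xzy_zxy x y z : x < y < z ->
  exchangeable [:: x; z; y] [:: z; x; y].
Proof.
move=> xyz; have pl : perm_eq [:: x; z; y] [:: z; x; y].
  by apply/permEl/(perm_catCA [:: x] [:: z] [:: y]).
split=> // a b uw j m; split=> -[c cw <-]; first exact: coverable_knuth_xzy_zxy.
apply: (coverable_transpose (b := y :: b)) => //.
by rewrite /compatible; lia.
Qed.

Lemma exchangeable_knuth_yxz_yzx x y z : x < y < z ->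
  exchangeable [:: y; x; z] [:: y; z; x].
Proof.
move=> xyz; have pl : perm_eq [:: y; x; z] [:: y; z; x].
  by rewrite perm_cons; apply/permEl/(perm_catC [:: x] [:: z]).
split=> // a b uw j m; split=> -[c cw <-]; first exact: coverable_knuth_yxz_yzx.
have := @coverable_transpose j c (a ++ [:: y]) b x z; rewrite -!catA; apply=> //.
by rewrite /compatible; lia.
Qed.

(** The letter [k], placed at the end of a row, moves left past all the entries
    that follow the bumped entry [y]. *)
Lemma exchangeable_tail y k v : k < y -> path ltn y v ->
  exchangeable (y :: rcons v k) (y :: k :: v).
Proof.
elim: v y => [|v1 v IH] y ky /=; first by move=> _; apply: exchangeable_refl.
case/andP=> yv1 pv.
apply: (exchangeable_trans (v := [:: y, v1, k & v])).
  have := exchangeable_cat [:: y] [::] (IH v1 (ltn_trans ky yv1) pv).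
  by rewrite /= !cats0.
apply/exchangeable_sym.
have kyv1 : k < y < v1 by rewrite ky.
exact: (exchangeable_cat [::] v (exchangeable_knuth_yxz_yzx kyv1)).
Qed.

(** Once next to [k], the bumped entry [y] moves left past all the smaller
    entries of the row, and so leaves it at the front. *)
Lemma exchangeable_head y k u : k < y -> sorted ltn (rcons u k) ->
  exchangeable (u ++ [:: y; k]) (y :: rcons u k).
Proof.
move=> ky; elim: u => [|x u IH] /= pu; first exact: exchangeable_refl.
have su := path_sorted pu.
apply: (exchangeable_trans (v := [:: x, y & rcons u k])).
  have := exchangeable_cat [:: x] [::] (IH su).
  by rewrite /= !cats0.
case E: (rcons u k) => [|h s]; first by case: (u) E.
rewrite E in pu.
have hk : h <= k.
  have hs : sorted leq (h :: s) by rewrite -E; apply: sub_sorted su => ? ?; apply: ltnW.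
  have : k \in h :: s by rewrite -E mem_rcons mem_head.
  rewrite inE => /orP[/eqP->//|ks].
  by move: hs => /= /(order_path_min leq_trans)/allP/(_ k ks).
have xhy : x < h < y by move: pu => /= /andP[]; lia.
exact: (exchangeable_cat [::] s (exchangeable_knuth_xzy_zxy xhy)).
Qed.

(** * Insertion into a tableau *)

(** When no entry of the row exceeds [k], the position found is the size of the
    row, and [set_nth] appends [k] ([row_insert_end]). *)
Definition row_insert (row : seq nat) (k : nat) :=
  set_nth 0 row (find (ltn k) row) k.

Definition bumped (row : seq nat) (k : nat) := nth 0 row (find (ltn k) row).

Lemma row_insert_end row k : ~~ has (ltn k) row -> row_insert row k = rcons row k.
Proof. by move=> /hasNfind E; rewrite /row_insert E set_nthE ltnn subnn cats1. Qed.

Lemma rs_insert_cons row P k : sorted ltn row ->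
  rs_insert (row :: P) k =
  if has (ltn k) row then
    (row_insert row k :: (rs_insert P (bumped row k)).1,
     (rs_insert P (bumped row k)).2.+1)
  else (rcons row k :: P, 0).
Proof.
move=> srow /=.
have -> : (row == [::]) || (last 0 row <= k) = ~~ has (ltn k) row.
  case/lastP: row srow => // s x srow.
  rewrite -size_eq0 size_rcons last_rcons has_rcons /= leqNgt; congr (~~ _).
  apply/idP/orP => [|[//|/hasP[y ys /= ky]]]; [by left|].
  apply: ltn_trans ky _.
  move: srow; rewrite (sorted_pairwise ltn_trans) -cats1 => /pairwise_catP[_ _].
  by apply; rewrite ?mem_head.
rewrite -/(bumped row k) -/(row_insert row k) if_neg.
by case: (rs_insert P _).
Qed.

Lemma row_insertP row k : sorted ltn row -> k \notin row -> has (ltn k) row ->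
  exists u v, let y := bumped row k in
    [/\ row = u ++ y :: v, row_insert row k = u ++ k :: v, k < y
      & sorted ltn (u ++ k :: v)].
Proof.
move=> srow krow kh; have ps := kh; rewrite has_find in ps.
set p := find (ltn k) row in ps.
exists (take p row), (drop p.+1 row) => y.
have ky : k < y by apply: (nth_find 0 kh).
have Erow : row = take p row ++ y :: drop p.+1 row.
  by rewrite -drop_nth // cat_take_drop.
split=> //; first by rewrite /row_insert set_nthE ps.
have ltu v : v \in take p row -> v < k.
  move=> vu; rewrite ltn_neqAle leqNgt; apply/andP; split.
    by apply: contraNneq krow => <-; apply: mem_take vu.
  apply/negP => kv; have := index_mem v (take p row); rewrite vu size_take ps => ip.
  by have := before_find 0 ip; rewrite /= -(nth_take 0 ip) nth_index // kv.
move: srow; rewrite !(sorted_pairwise ltn_trans) {1}Erow.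
move=> /pairwise_catP[su /= /andP[/allP yv sv] uyv].
apply/pairwise_catP; split=> //=.
  by rewrite sv andbT; apply/allP => v /yv; apply: ltn_trans.
move=> u v uu; rewrite inE => /orP[/eqP->|vv]; first exact: ltu.
by apply: uyv => //; rewrite inE vv orbT.
Qed.

Lemma exchangeable_row row k : sorted ltn row -> k \notin row -> has (ltn k) row ->
  exchangeable (rcons row k) (bumped row k :: row_insert row k).
Proof.
move=> srow krow kh; have [u [v /= [Erow -> ky sk]]] := row_insertP srow krow kh.
set y := bumped row k in Erow ky *.
have yv : path ltn y v by move: srow; rewrite Erow => /cat_sorted2[].
have uk : sorted ltn (rcons u k) by move: sk; rewrite -cat_rcons => /cat_sorted2[].
rewrite Erow rcons_cat rcons_cons.
apply: (exchangeable_trans (v := u ++ [:: y, k & v])).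
  by have := exchangeable_cat u [::] (exchangeable_tail ky yv); rewrite !cats0.
by have := exchangeable_cat [::] v (exchangeable_head ky uk); rewrite /= -catA cat_rcons.
Qed.

Definition dominates (r1 r2 : seq nat) :=
  size r2 <= size r1 /\ forall i, i < size r2 -> nth 0 r1 i < nth 0 r2 i.

Lemma dominates_rcons r1 r2 k : dominates r1 r2 -> dominates (rcons r1 k) r2.
Proof.
move=> [s12 lt12]; split=> [|i ir2]; first by rewrite size_rcons ltnW.
by rewrite nth_rcons (leq_trans ir2 s12) lt12.
Qed.

(** The entry [y] bumped from position [p] of the upper row settles in the lower
    row at some position [q <= p], for the entry below [y], if any, exceeds [y].
    Hence [y] comes below an entry smaller than itself, and no entry of the
    upper row has grown. *)
Lemma dominates_insert r1 r2 k : sorted ltn r1 -> dominates r1 r2 ->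
  has (ltn k) r1 -> dominates (row_insert r1 k) (row_insert r2 (bumped r1 k)).
Proof.
rewrite /row_insert; set y := bumped r1 k; set p := find _ r1; set q := find _ r2.
move=> sr1 [s12 lt12] kr1.
have ps : p < size r1 by rewrite -has_find.
have ky : k < y by apply: (nth_find 0 kr1).
have qp : q <= p.
  rewrite leqNgt; apply/negP => pq.
  have pr2 : p < size r2 by apply: leq_trans pq (find_size _ _).
  by have := before_find 0 pq; rewrite /= lt12.
split=> [|i]; rewrite !size_set_nth; first by lia.
have r1lt i1 : i1 < p -> nth 0 r1 i1 < y.
  by move=> i1p; apply: (sorted_ltn_nth ltn_trans) => //; rewrite !inE //; lia.
move=> iq; rewrite !nth_set_nth /=; have [->|niq] := eqVneq i q.
  by case: eqP => // /eqP; rewrite neq_ltn (ltnNge p) qp orbF; apply: r1lt.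
have ir2 : i < size r2 by have := find_size (ltn y) r2; lia.
have := lt12 _ ir2; case: eqP => // -> .
by apply: ltn_trans.
Qed.

(** The default value of [head] makes the condition below the last row vacuous. *)
Fixpoint standard (P : tableau) : Prop :=
  if P is row :: P' then
    [/\ sorted ltn row, dominates row (head [::] P') & standard P']
  else True.

Definition reading (P : tableau) : seq nat := flatten (rev P).

Lemma reading_cons row P : reading (row :: P) = reading P ++ row.
Proof. by rewrite /reading rev_cons flatten_rcons. Qed.

(** The description of the first row of the result is what the induction needs
    to compare the row above it with that first row. *)
Lemma rs_insert_correct P k : standard P -> uniq (k :: reading P) ->
  [/\ standard (rs_insert P k).1,
      head [::] (rs_insert P k).1 = row_insert (head [::] P) k
    & exchangeable (rcons (reading P) k) (reading (rs_insert P k).1)].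
Proof.
elim: P k => [|row P IH] k; first by move=> _ _; split=> //; apply: exchangeable_refl.
move=> [srow dom stP]; rewrite rs_insert_cons // reading_cons.
rewrite /= mem_cat negb_or cat_uniq => /andP[/andP[kP krow] /and3P[uP /hasPn disj urow]].
case: ifPn => kh /=; last first.
  rewrite row_insert_end //; split=> //; last first.
    by rewrite reading_cons rcons_cat; apply: exchangeable_refl.
  split=> //; last exact: dominates_rcons.
  rewrite -cats1 !(sorted_pairwise ltn_trans) in srow *.
  apply/pairwise_catP; split=> // u v ur; rewrite inE => /eqP->.
  have /hasPn/(_ _ ur) /= := kh; rewrite -leqNgt leq_eqVlt => /orP[/eqP uk|//].
  by rewrite -uk ur in krow.
have yrow : bumped row k \in row by apply: mem_nth; rewrite -has_find.
have uy : uniq (bumped row k :: reading P) by rewrite /= uP (disj _ yrow).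
have [stQ hQ exQ] := IH _ stP uy.
have [u [v /= [_ Eins _ sins]]] := row_insertP srow krow kh.
split=> //.
  by split; rewrite // ?Eins // -Eins hQ; apply: dominates_insert.
rewrite reading_cons.
apply: (exchangeable_trans (v := rcons (reading P) (bumped row k) ++ row_insert row k)).
  have := exchangeable_cat (reading P) [::] (exchangeable_row srow krow kh).
  by rewrite !cats0 rcons_cat cat_rcons.
exact: (exchangeable_cat [::] _ exQ).
Qed.

(** Only the last row reached by the insertion gains an entry. The default value
    of [nth] gives size 0 to a row that does not exist yet. *)
Lemma rs_insert_row_sizes P k j : standard P ->
  \sum_(r < j) size (nth [::] (rs_insert P k).1 r) =
  \sum_(r < j) size (nth [::] P r) + ((rs_insert P k).2 < j).
Proof.
elim: P k j => [|row P IH] k [|j] st; rewrite ?big_ord0 ?ltn0 ?addn0 //.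
  by rewrite big_ord_recl [in RHS]big_ord_recl /= !big1 // => i _; rewrite nth_nil.
case: st => srow _ stP; rewrite rs_insert_cons //; case: ifP => kh /=.
  rewrite !big_ord_recl /= IH // addnA; congr (_ + _ + _).
  by rewrite size_set_nth; apply/maxn_idPr; rewrite -has_find.
by rewrite !big_ord_recl /= size_rcons addn1 addSn.
Qed.

(** * Colourings of the reading word of a tableau *)

Lemma dominates_trans r2 r1 r3 : dominates r1 r2 -> dominates r2 r3 -> dominates r1 r3.
Proof.
move=> [s12 lt12] [s23 lt23]; split=> [|i i3]; first exact: leq_trans s12.
by apply: ltn_trans (lt23 _ i3); apply: lt12; apply: leq_trans s23.
Qed.

Lemma standard_dominates P r r' : standard P -> r < r' ->
  dominates (nth [::] P r) (nth [::] P r').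
Proof.
move=> stP; elim: r' => // r' IH; rewrite ltnS leq_eqVlt => lerr'.
have step : dominates (nth [::] P r') (nth [::] P r'.+1).
  elim: P r' stP {IH lerr'} => [|row P IH] [|r''] //= [_ ? ?].
    by rewrite nth0.
  exact: IH.
case/orP: lerr' => [/eqP-> //|/IH d]; apply: dominates_trans d step.
Qed.

Lemma count_nth p (s : seq nat) N : size s <= N ->
  count p s = \sum_(i < N) ((i < size s) && p (nth 0 s i)).
Proof.
elim: s N => [|x s IH] N; first by rewrite big1.
by case: N => // N sN; rewrite big_ord_recl /= (IH N).
Qed.

Lemma count_reading p P M : size P <= M ->
  count p (reading P) = \sum_(r < M) count p (nth [::] P r).
Proof.
elim: P M => [|row P IH] M; first by rewrite big1 // => i _; rewrite nth_nil.
by case: M => // M sM; rewrite big_ord_recl reading_cons count_cat (IH M) // addnC.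
Qed.

(** Lower rows are read first. *)
Lemma coloring_rows j c P r r' u v : coloring j c (reading P) -> r < r' ->
  u \in nth [::] P r' -> v \in nth [::] P r -> compatible j c u v.
Proof.
elim: P r r' => [|row P IH] r r'; first by rewrite nth_nil.
rewrite reading_cons => /pairwise_catP[cP _ cross].
case: r r' => [|r] [|r'] //=; last exact: (IH r r' cP).
move=> _ ur' vrow; apply: cross => //; apply/flattenP.
have r'P : r' < size P by rewrite ltnNge; apply: contraL ur' => /(nth_default _)->.
by exists (nth [::] P r') => //; rewrite mem_rev mem_nth.
Qed.

(** If the column meets row [j], it contributes at most one letter per colour,
    because equal colours would decrease along the reading word, and it meets
    all the first [j] rows. Otherwise all of it lies in these rows. The sum over
    [M + j] rows is one that covers all rows, while having the first [j] of
    them as an initial segment. *)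
Lemma column_covered j c P i M : standard P -> coloring j c (reading P) ->
  \sum_(r < M + j) ((i < size (nth [::] P r)) && (c (nth 0 (nth [::] P r) i) < j))
  <= \sum_(r < j) (i < size (nth [::] P r)).
Proof.
move=> stP cP; have [long|short] := ltnP i (size (nth [::] P j)).
  have -> : \sum_(r < j) (i < size (nth [::] P r)) = j.
    rewrite (eq_bigr (fun _ => 1)) ?sum1_card ?card_ord // => r _.
    have [sr _] := standard_dominates stP (ltn_ord r).
    by rewrite (leq_trans long sr).
  pose cell (r : 'I_(M + j)) := nth 0 (nth [::] P r) i.
  pose A := [set r : 'I_(M + j) | (i < size (nth [::] P r)) && (c (cell r) < j)].
  have -> : \sum_(r < M + j) ((i < size (nth [::] P r)) && (c (cell r) < j)) = #|A|.
    by rewrite -sum1dep_card [RHS]big_mkcond; apply: eq_bigr => r _; case: (_ && _).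
  rewrite cardE -(size_map (c \o cell)) -[leqRHS](size_iota 0); apply: uniq_leq_size.
    rewrite map_inj_in_uniq ?enum_uniq // => r r'; rewrite !mem_enum !inE.
    move=> /andP[ir cr] /andP[ir' cr'] /= err'; apply: val_inj => /=.
    wlog lt : r r' ir cr ir' cr' err' / r < r'.
      move=> W; case: (ltngtP r r') => // rr; first exact: W.
      by apply/esym/W.
    have := coloring_rows cP lt (mem_nth 0 ir') (mem_nth 0 ir).
    rewrite /compatible -/(cell r) -/(cell r') cr' err' eqxx /= ltnNge.
    have [_ /(_ _ ir')] := standard_dominates stP lt.
    by rewrite -/(cell r) -/(cell r') => /ltnW->.
  by move=> k /mapP[r]; rewrite mem_enum inE mem_iota => /andP[_ cr] ->.
rewrite addnC big_split_ord /= [X in _ + X]big1 ?addn0 => [|r _]; last first.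
  rewrite ltnNge; case: (posnP r) => [->|r0]; first by rewrite addn0 short.
  have [sr _] : dominates (nth [::] P j) (nth [::] P (j + r)).
    by apply: standard_dominates; rewrite // -[ltnLHS]addn0 ltn_add2l.
  by rewrite (leq_trans sr short).
by apply: leq_sum => r _; case: (i < _) => //=; case: (_ < _).
Qed.

Lemma coverable_reading_le j P m : standard P -> coverable j (reading P) m ->
  m <= \sum_(r < j) size (nth [::] P r).
Proof.
move=> stP [c cP <-]; set N := size (nth [::] P 0).
have sN r : size (nth [::] P r) <= N.
  by case: r => // r; have [] := standard_dominates stP (ltn0Sn r).
rewrite (count_reading _ (leq_addr j _)).
under eq_bigr => r _ do rewrite (count_nth _ (sN r)).
under [X in _ <= X]eq_bigr => r _ do rewrite -count_predT (count_nth _ (sN r)).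
rewrite exchange_big [X in _ <= X]exchange_big /=.
apply: leq_sum => i _; under [X in _ <= X]eq_bigr => r _ do rewrite andbT.
exact: column_covered.
Qed.

(** Each of the first [j] rows is one colour class. *)
Lemma coverable_reading j P : standard P -> uniq (reading P) ->
  coverable j (reading P) (\sum_(r < j) size (nth [::] P r)).
Proof.
elim: P j => [|row P IH] [|j]; rewrite ?big_ord0.
- by exists id.
- by exists id; rewrite //= big1 // => i _; rewrite nth_nil.
- move=> _ _; exists id; last by rewrite count_pred0.
  by apply/(pairwiseP 0) => u v.
move=> [srow _ stP]; rewrite reading_cons cat_uniq => /and3P[uP /hasPn disj urow].
have [c cP nc] := IH j stP uP.
pose c' v := if v \in row then 0 else (c v).+1.
have Erow v : v \in row -> c' v = 0 by rewrite /c' => ->.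
have EP v : v \in reading P -> c' v = (c v).+1.
  by move=> vP; rewrite /c' ifN //; apply: contraL vP => /disj.
exists c'; last first.
  rewrite count_cat big_ord_recl /= -nc addnC; congr (_ + _).
    by rewrite -count_predT; apply: eq_in_count => v /Erow->.
  by apply: eq_in_count => v /EP->.
apply/pairwise_catP; split.
- rewrite /coloring in cP; apply: (sub_in_pairwise (P := mem (reading P))) cP.
    by move=> u v uP' vP'; rewrite /compatible !EP.
  exact/allP.
- rewrite (sorted_pairwise ltn_trans) in srow.
  by apply: sub_pairwise srow => u v uv; rewrite /compatible uv implybT.
- by move=> u v uP' vrow; rewrite /compatible EP // Erow // andbF.
Qed.

(** * Greene's theorem *)

Lemma P_tableau_rcons w k : P_tableau (rcons w k) = (rs_insert (P_tableau w) k).1.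
Proof. exact: foldl_rcons. Qed.

Lemma P_tableau_correct w : uniq w ->
  standard (P_tableau w) /\ exchangeable w (reading (P_tableau w)).
Proof.
elim/last_ind: w => [|w k IH]; first by split=> //; apply: exchangeable_refl.
rewrite rcons_uniq P_tableau_rcons => /andP[kw uw].
have [stP exP] := IH uw.
have uk : uniq (k :: reading (P_tableau w)).
  by rewrite -(perm_uniq (s1 := k :: w)) /= ?kw // perm_cons; case: exP.
have [stQ _ exQ] := rs_insert_correct stP uk; split=> //.
apply: exchangeable_trans exQ.
by rewrite -!cats1; apply: (exchangeable_cat [::] [:: k] exP).
Qed.

(** [increasing] speaks of consecutive chosen positions; this is the form for
    arbitrary pairs, in which colourings are stated. *)
Lemma increasingP (w : seq nat) (A : {set 'I_(size w)}) :
  reflect {in A &, forall p q : 'I_(size w), p < q -> nth 0 w p < nth 0 w q}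
          (increasing A).
Proof.
rewrite /increasing /subword (sorted_pairwise ltn_trans) pairwise_map.
have ltA : pairwise (relpre (@nat_of_ord (size w)) ltn) (enum A).
  apply: (subseq_pairwise (ys := enum 'I_(size w))).
    by rewrite {1}/enum_mem -enumT; exact: filter_subseq.
  by rewrite -pairwise_map val_enum_ord -(sorted_pairwise ltn_trans) iota_ltn_sorted.
apply: (iffP idP) => [incA p q pA qA pq|incA]; last first.
  apply: (sub_in_pairwise (P := mem A)) ltA => //; apply/allP => p.
  by rewrite mem_enum.
have /(pairwiseP p) both : pairwise [rel p q : 'I_(size w) |
    (p < q) && (nth 0 w p < nth 0 w q)] (enum A).
  by rewrite pairwise_relI; apply/andP; split.
have iA x : x \in A -> index x (enum A) < size (enum A) by rewrite index_mem mem_enum.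
case: (ltngtP (index p (enum A)) (index q (enum A))) => [|lt|E].
- move=> /(both _ _ (iA _ pA) (iA _ qA)).
  by rewrite !nth_index ?mem_enum //= => /andP[].
- have := both _ _ (iA _ qA) (iA _ pA) lt.
  by rewrite !nth_index ?mem_enum //= ltnNge (ltnW pq).
- have Epq : p = q.
    by rewrite -(nth_index p (s := enum A) (x := p)) ?mem_enum // E nth_index ?mem_enum.
  by rewrite Epq ltnn in pq.
Qed.

Lemma count_card (p : pred nat) w :
  count p w = #|[set i : 'I_(size w) | p (nth 0 w i)]|.
Proof.
rewrite (count_nth _ (leqnn _)) -sum1dep_card [RHS]big_mkcond.
by apply: eq_bigr => i _; rewrite ltn_ord; case: (p _).
Qed.

Lemma coverable_max_union j w m : coverable j w m -> m <= max_union_incr j w.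
Proof.
move=> [c cw <-].
pose F := [ffun t : 'I_j => [set p : 'I_(size w) | c (nth 0 w p) == t]].
have -> : count (fun v => c v < j) w = #|\bigcup_(t < j) F t|.
  rewrite count_card; apply: eq_card => p; rewrite inE.
  apply/idP/bigcupP => [cp|[t _]]; last by rewrite ffunE inE => /eqP->.
  by exists (Ordinal cp); rewrite // ffunE inE.
apply: (leq_bigmax_cond (F := fun F : {ffun 'I_j -> {set _}} => #|\bigcup_(t < j) F t|)).
apply/forallP => t; apply/increasingP => p q; rewrite ffunE !inE => /eqP cp /eqP cq pq.
have /(pairwiseP 0)/(_ p q (ltn_ord p) (ltn_ord q) pq) := cw.
by rewrite /compatible cp cq ltn_ord eqxx.
Qed.

(** Where the sets of the family overlap, any choice of one of them will do,
    since a part of an increasing subsequence is increasing. *)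
Lemma family_coverable j w (F : {ffun 'I_j -> {set 'I_(size w)}}) :
  uniq w -> [forall t, increasing (F t)] -> coverable j w #|\bigcup_(t < j) F t|.
Proof.
move=> uw /forallP incF.
pose c v := if [pick t | v \in subword (F t)] is Some t then nat_of_ord t else j.
have memF (p : 'I_(size w)) t : (nth 0 w p \in subword (F t)) = (p \in F t).
  apply/mapP/idP => [[q]|pF]; last by exists p; rewrite ?mem_enum.
  by rewrite mem_enum => qF /eqP; rewrite nth_uniq // => /eqP/val_inj->.
exists c; last first.
  rewrite count_card; apply: eq_card => p; rewrite inE /c; apply/idP/bigcupP.
    by case: pickP => [t|]; rewrite ?ltnn // memF => pF _; exists t.
  by move=> [t _ pF]; case: pickP => // /(_ t); rewrite memF pF.
apply/(pairwiseP 0) => p q; rewrite !inE => pw qw pq.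
rewrite /compatible; apply/implyP => /andP[]; rewrite /c.
case: pickP => [t|]; last by rewrite ltnn.
case: pickP => [t'|]; last first.
  by move=> _ _ _ /eqP tj; have := ltn_ord t; rewrite tj ltnn.
rewrite (memF (Ordinal qw)) (memF (Ordinal pw)) => qF pF _ /eqP/val_inj tt'.
by rewrite -tt' in qF; have /increasingP/(_ _ _ pF qF pq) := incF t.
Qed.

Theorem greene j w : uniq w ->
  max_union_incr j w = \sum_(r < j) size (nth [::] (P_tableau w) r).
Proof.
move=> uw; have [stP [pP exP]] := P_tableau_correct uw.
have E m : coverable j w m <-> coverable j (reading (P_tableau w)) m.
  by have := exP [::] [::]; rewrite /= !cats0; apply.
apply/eqP; rewrite eqn_leq; apply/andP; split.
  apply/bigmax_leqP => F incF; apply: coverable_reading_le => //.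
  exact/E/family_coverable.
apply: coverable_max_union; apply/E/coverable_reading => //.
by rewrite -(perm_uniq pP).
Qed.

Lemma one_line_uniq n (pi : 'S_n) : uniq (one_line pi).
Proof. by rewrite map_inj_uniq ?enum_uniq // => x y [] /val_inj/perm_inj. Qed.

Theorem proposition11 (n : nat) (pi : 'S_n) (i : nat)
    (hn : 1 <= n) (hi : 1 <= i <= n) :
  exists j : nat,
    is_smallest
      (fun j => 1 <= j /\
         max_union_incr j (take i (one_line pi)) >
         max_union_incr j (take i.-1 (one_line pi))) j /\
    rs_bump i pi + 1 = j.
Proof.
case: i hi => // i /andP[_ lt_in]; exists (rs_bump i.+1 pi + 1); split=> //.
have gain j : (max_union_incr j (take i (one_line pi)) <
               max_union_incr j (take i.+1 (one_line pi))) = (rs_bump i.+1 pi < j).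
  have uw := take_uniq i (one_line_uniq pi).
  rewrite !greene ?take_uniq ?one_line_uniq //.
  (* Positions and indices of rows start at 0: letter [i] of the word is the one
     inserted last. *)
  have szi : i < size (one_line pi) by rewrite size_map -cardE card_ord.
  rewrite (take_nth 0 szi) P_tableau_rcons.
  rewrite rs_insert_row_sizes; last by have [] := P_tableau_correct uw.
  by rewrite -[ltnLHS]addn0 ltn_add2l lt0b.
rewrite addn1; split=> [|j [_]]; first by split=> //=; rewrite gain.
by rewrite /= gain.
Qed.
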